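(* A price vector $\boldsymbol{\rho}^*\in\mathbb{R}^{\mathcal S}$ is an optimal solution of the bi-level problem $$\min_{\boldsymbol{\rho}\in\mathbb{R}^{\mathcal S}}\ \sum_{s\in\mathcal S} m_s\quad\text{subject to}\quad m_s=\Big|\sum_{r\in\mathcal R}q_{rs}-(D_s-b_s\rho_s)\Big|\ \ \forall s\in\mathcal S,\quad \mathbf q \text{ part of an optimal solution of the lower-level problem } \mathrm{(LL}(\boldsymbol\rho)\mathrm{)},$$ if and only if ride supply and ride demand are balanced at each location given $\boldsymbol{\rho}^*$, i.e. $\sum_{r\in\mathcal R}q^*_{rs}(\boldsymbol{\rho}^* )=D_s-b_s\rho^*_s$ for all $s\in\mathcal S$, where $\mathbf q^*(\boldsymbol\rho^* )$ denotes the optimal $\mathbf q$ of $\mathrm{(LL}(\boldsymbol\rho^* )\mathrm{)}$. In addition, $\boldsymbol{\rho}^*$ is unique.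
   Context: Setting. $\mathcal G=(\mathcal N,\mathcal A)$ is a finite directed graph (transportation network) with node-link incidence matrix $A$ (in each link's column, entry $1$ at its starting node, $-1$ at its ending node, $0$ elsewhere). $\mathcal R\subset\mathcal N$ is the set of driver nodes, $\mathcal S\subset\mathcal N$ the set of rider nodes, $\mathcal K\subset\mathcal N$ the set of final destinations of vehicles departing from rider nodes. The network is interconnected: every $s\in\mathcal S$ can be reached from every $r\in\mathcal R$ and every $k\in\mathcal K$ from every $s\in\mathcal S$ by directed paths. For nodes $i,j$, $E_{ij}\in\mathbb R^{\mathcal N}$ is the O-D incidence vector with $1$ at $i$, $-1$ at $j$ and $0$ elsewhere, with $E_{ij}=\mathbf 0$ if $i=j$. For each link $a$, $t_a:[0,\infty)\to[0,\infty)$ is its travel time function, continuous and strictly increasing. Data: $Q_r>0$ is the number of drivers initially at $r\in\mathcal R$; $\bar D_s\ge0$ is the total number of vehicles departing from $s$; $\delta_{sk}\ge 0$ is the fraction of the travel originating from $s$ that goes to $k$; $\beta_{0,s}\in\mathbb R$, $\beta_1>0$, $\beta_2>0$ are utility parameters; $D_s$ and $b_s>0$ are the coefficients of the linear ride demand function $D_s-b_s\rho_s$ at location $s$, where $\rho_s$ is the price at $s$. Lower-level problem $\mathrm{(LL}(\boldsymbol\rho)\mathrm{)}$, given prices $\boldsymbol\rho$: over nonnegative link-flow vectors $\hat{\mathbf v}_{rs}\in\mathbb R_+^{\mathcal A}$ ($r\in\mathcal R,s\in\mathcal S$; drivers), $\check{\mathbf v}_{sk}\in\mathbb R_+^{\mathcal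 A}$ ($s\in\mathcal S,k\in\mathcal K$; passenger vehicles) and relocation flows $q_{rs}\ge 0$, $$\min\ \sum_{a\in\mathcal A}\int_0^{v_a}t_a(u)\,du+\frac1{\beta_1}\sum_{r\in\mathcal R}\sum_{s\in\mathcal S}q_{rs}\big(\ln q_{rs}-1-\beta_2\rho_s-\beta_{0,s}\big)$$ subject to $\mathbf v=\sum_{r,s}\hat{\mathbf v}_{rs}+\sum_{s,k}\check{\mathbf v}_{sk}$; $A\hat{\mathbf v}_{rs}=q_{rs}E_{rs}$ for all $r,s$; $A\check{\mathbf v}_{sk}=\bar d_{sk}E_{sk}$ for all $s,k$; $\sum_{s\in\mathcal S}q_{rs}=Q_r$ for all $r$; $\bar d_{sk}=\delta_{sk}\bar D_s$ for all $s,k$. Convention: $0\ln 0=0$. *)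

(* Defs.v *)
(* MathComp-Analysis; the reals are an arbitrary [R : realType]. *)
From HB Require Import structures.
From mathcomp Require Import all_boot all_order all_algebra.
From mathcomp Require Import all_classical all_reals all_analysis.

Set Implicit Arguments.
Unset Strict Implicit.
Unset Printing Implicit Defensive.

Import Order.TTheory GRing.Theory Num.Theory.
Import numFieldNormedType.Exports.

Local Open Scope ring_scope.

(* Index type for vectors indexed by a subset of the nodes. The subsets of
   driver, rider and destination nodes may overlap. *)
Notation elt S := {x | x \in S}.

(* Links form a type of their own with two endpoint maps, so parallel links are
   allowed. Sign and regularity conditions on the data are not part of the
   record. *)
Record market (R : realType) := Market {
  node : finType;
  link : finType;
  start : link -> node;
  finish : link -> node;
  drivers : {set node};
  riders : {set node};
  dests : {set node};
  ttime : link -> R -> R;                    (* t_a, relevant on [0, +oo) *)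
  Q : elt drivers -> R;
  Dbar : elt riders -> R;
  delta : elt riders -> elt dests -> R;
  beta0 : elt riders -> R;
  beta1 : R;
  beta2 : R;
  D : elt riders -> R;                       (* demand at s: D s - b s * rho s *)
  b : elt riders -> R
}.

Section Market.
Variables (R : realType) (G : market R).

Definition reachable (i j : node G) : bool :=
  connect [rel x y | [exists a : link G, (start a == x) && (finish a == y)]] i j.

(* On a link from a node to itself the column is zero. *)
Definition incidence (n : node G) (a : link G) : R :=
  (start a == n)%:R - (finish a == n)%:R.

(* In particular [od i i] is the zero vector. *)
Definition od (i j n : node G) : R := (n == i)%:R - (n == j)%:R.

(* A v = d E_ij *)
Definition balanced_flow (v : link G -> R) (d : R) (i j : node G) : Prop :=
  forall n, \sum_a incidence n a * v a = d * od i j n.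

Definition demand_sk (s : elt (riders G)) (k : elt (dests G)) : R :=
  delta s k * Dbar s.

Record ll_point := LLPoint {
  vhat : elt (drivers G) -> elt (riders G) -> link G -> R;
  vcheck : elt (riders G) -> elt (dests G) -> link G -> R;
  reloc : elt (drivers G) -> elt (riders G) -> R
}.

Definition link_flow (x : ll_point) (a : link G) : R :=
  \sum_r \sum_s vhat x r s a + \sum_s \sum_k vcheck x s k a.

Record ll_feasible (x : ll_point) : Prop := LLFeasible {
  vhat_ge0 : forall r s a, 0 <= vhat x r s a;
  vcheck_ge0 : forall s k a, 0 <= vcheck x s k a;
  reloc_ge0 : forall r s, 0 <= reloc x r s;
  vhat_flow : forall r s,
    balanced_flow (vhat x r s) (reloc x r s) (val r) (val s);
  vcheck_flow : forall s k,
    balanced_flow (vcheck x s k) (demand_sk s k) (val s) (val k);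
  reloc_sum : forall r, \sum_s reloc x r s = Q r
}.

(* The convention 0 ln 0 = 0 holds because [ln 0] is a real number. *)
Definition ll_obj (rho : elt (riders G) -> R) (x : ll_point) : R :=
  (\sum_a \int[lebesgue_measure]_(u in `[0, link_flow x a]) (ttime a u))
  + (beta1 G)^-1 *
    \sum_r \sum_s
       reloc x r s * (ln (reloc x r s) - 1 - beta2 G * rho s - beta0 s).

Definition ll_optimal (rho : elt (riders G) -> R) (x : ll_point) : Prop :=
  ll_feasible x /\ forall y, ll_feasible y -> ll_obj rho x <= ll_obj rho y.

Definition ll_optimal_reloc (rho : elt (riders G) -> R)
    (q : elt (drivers G) -> elt (riders G) -> R) : Prop :=
  exists2 x, ll_optimal rho x & reloc x = q.

Definition bilevel_feasible (rho m : elt (riders G) -> R)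
    (q : elt (drivers G) -> elt (riders G) -> R) : Prop :=
  ll_optimal_reloc rho q /\
  forall s, m s = `| \sum_r q r s - (D s - b s * rho s) |.

Definition bilevel_optimal (rho : elt (riders G) -> R) : Prop :=
  exists m q, bilevel_feasible rho m q /\
    forall rho' m' q', bilevel_feasible rho' m' q' ->
      \sum_s m s <= \sum_s m' s.

(* The balance condition speaks of "the" optimal q of the lower level, hence
   the definite description: the optimal q exists, is unique, and balances. *)
Definition market_balanced (rho : elt (riders G) -> R) : Prop :=
  exists q, unique (ll_optimal_reloc rho) q /\
    forall s, \sum_r q r s = D s - b s * rho s.

End Market.

(* Main.v *)
(* A balancing price is obtained from a single convex program: charge each rider
   node s with minus the area under its inverse demand curve, as a function of
   the supply d_s, instead of with the linear price term. A minimizer x exists,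
   since travel costs grow at least linearly and the relocation flows are
   bounded; first-order optimality of x says that x solves the lower-level
   problem at the price rho_s = (D_s - d_s) / b_s, which balances the market.
   Hence the bi-level optimal value is 0, and optimality means balance. Strict
   convexity of q ln q makes the relocation flows unique at each price, and
   monotonicity of supply in the price makes the balancing price unique. *)
Require Import Defs.
From HB Require Import structures.
From mathcomp Require Import all_boot all_order all_algebra.
From mathcomp Require Import all_classical all_reals all_analysis.
From mathcomp Require Import ring lra.

Set Implicit Arguments.
Unset Strict Implicit.
Unset Printing Implicit Defensive.

Import Order.TTheory GRing.Theory Num.Theory.
Import numFieldNormedType.Exports.

Local Open Scope classical_set_scope.
Local Open Scope ring_scope.

Section TravelCost.
Variables (R : realType) (t : R -> R).
Hypotheses (t_ge0 : forall u, 0 <= u -> 0 <= t u)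
  (t_cont : {within `[0, +oo[%classic, continuous t})
  (t_incr : forall u w, 0 <= u -> u < w -> t u < t w).

Let F (v : R) : R := \int[lebesgue_measure]_(u in `[0, v]) t u.

Let t_le u w : 0 <= u -> u <= w -> t u <= t w.
Proof. by move=> u0; rewrite le_eqVlt => /predU1P[->//|/(t_incr u0)/ltW]. Qed.

Let t_integrable (v : R) :
  (@lebesgue_measure R).-integrable `[0, v] (EFin \o t).
Proof.
apply: continuous_compact_integrable; first exact: segment_compact.
apply: continuous_subspaceW t_cont => x /=.
by rewrite !in_itv/= => /andP[->].
Qed.

Lemma travel_cost_ge0 v : 0 <= F v.
Proof.
apply: Rintegral_ge0 => u /=; rewrite in_itv/= => /andP[u0 _]; exact: t_ge0.
Qed.

Lemma travel_cost_npos v : v <= 0 -> F v = 0.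
Proof.
rewrite /F le_eqVlt => /predU1P[->|v0]; first by rewrite set_itv1 Rintegral_set1.
by rewrite set_itv_ge ?Rintegral_set0// bnd_simp -ltNge.
Qed.

Let cost_between v w : 0 <= v -> v <= w ->
  t v * (w - v) <= F w - F v <= t w * (w - v).
Proof.
move=> v0 vw.
have sub : [set` `]v, w]] `<=` [set` `[0, w]].
  move=> x /=; rewrite !in_itv/= => /andP[vx ->].
  by rewrite (le_trans v0 (ltW vx)).
have int_t : (@lebesgue_measure R).-integrable `]v, w] (EFin \o t).
  by apply: integrableS (t_integrable w).
have int_c (c : R) : (@lebesgue_measure R).-integrable `]v, w] (EFin \o cst c).
  have : (@lebesgue_measure R).-integrable `[v, w] (EFin \o cst c).
    apply: continuous_compact_integrable; first exact: segment_compact.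
    by apply: continuous_subspaceT => x; exact: cvg_cst.
  by apply: integrableS => //; apply: subset_itvr; rewrite bnd_simp.
have len (c : R) : \int[lebesgue_measure]_(u in `]v, w]) (cst c u) = c * (w - v).
  rewrite Rintegral_cst//= lebesgue_measure_itv/= lte_fin.
  case: ltP => [//|wv]; have -> : w = v by apply/le_anti; rewrite wv vw.
  by rewrite subrr.
rewrite (@Rintegral_itvB _ _ (BLeft 0) (BRight w)) ?bnd_simp//.
apply/andP; split; rewrite -len; apply: le_Rintegral => // u /=;
  rewrite in_itv/= => /andP[vu uw].
- exact/t_le/ltW.
- by apply: t_le => //; exact: le_trans v0 (ltW vu).
Qed.

Lemma travel_cost_subgradient v w : 0 <= v -> 0 <= w ->
  F v + t v * (w - v) <= F w.
Proof.
move=> v0 w0; have [vw|/ltW wv] := leP v w.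
  by have /andP[+ _] := cost_between v0 vw; lra.
by have /andP[_] := cost_between w0 wv; lra.
Qed.

Lemma travel_cost_continuous : continuous F.
Proof.
move=> v; pose m := Num.max v 0 + 1.
have m0 : 0 <= m by rewrite /m; case: (leP v 0); lra.
have tm0 := t_ge0 m0.
have F_max w : F w = F (Num.max w 0).
  by have [w0|//] := leP w 0; rewrite !travel_cost_npos.
have lip x y : 0 <= x <= m -> 0 <= y <= m -> F y - F x <= t m * `|x - y|.
  move=> /andP[x0 xm] /andP[y0 ym]; have := travel_cost_subgradient y0 x0.
  have := ler_wpM2r (normr_ge0 (x - y)) (t_le y0 ym).
  have := ler_wpM2l (t_ge0 y0) (lerNnormlW (lexx `|x - y|)).
  lra.
apply/cvgrPdist_le => e e0.
have d0 : 0 < Num.min 1 (e / (t m + 1)).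
  by rewrite lt_min ltr01 divr_gt0//; lra.
near=> w.
have : `|v - w| < Num.min 1 (e / (t m + 1)).
  by near: w; exact: (nbhsx_ballx v _ d0).
rewrite lt_min ltr_pdivlMr; last lra.
move=> /andP[vw1 vwe].
have vb : 0 <= Num.max v 0 <= m by rewrite /m; case: (leP v 0); lra.
have wb : 0 <= Num.max w 0 <= m.
  by rewrite /m; move: vw1; rewrite ltr_norml; case: (leP v 0); case: (leP w 0); lra.
have nv : `|Num.max v 0 - Num.max w 0| <= `|v - w|.
  case: (leP v 0); case: (leP w 0); rewrite ?subrr ?normr_ge0// => *;
  rewrite ler_norml; have := ler_norm (v - w); have := lerNnormlW (lexx `|v - w|); lra.
have nvt := ler_wpM2l tm0 nv.
have := lip _ _ vb wb; have := lip _ _ wb vb; rewrite -!F_max.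
rewrite (distrC (Num.max w 0)) ler_norml => h1 h2.
have := normr_ge0 (v - w); nra.
Unshelve. all: by end_near. Qed.

End TravelCost.

Section Entropy.
Variable R : realType.
Implicit Types p q c : R.

Lemma entropy_subgradient p q : 0 < p -> 0 <= q -> q != p ->
  p * ln p + (ln p + 1) * (q - p) < q * ln q.
Proof.
move=> p0; rewrite le_eqVlt => /predU1P[<-|q0] qp.
  by rewrite mul0r mulrDl mul1r sub0r mulrN [ln p * p]mulrC; lra.
have npq : p / q - 1 != 0.
  rewrite subr_eq0; apply: contra qp => /eqP pq.
  by rewrite -[q]mul1r -pq divfK ?(gt_eqF q0).
have : ln (p / q) < p / q - 1.
  rewrite -ltr_expR lnK ?posrE ?divr_gt0//.
  by have := expR_gt1Dx npq; rewrite addrC subrK.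
rewrite ln_div ?posrE// -(ltr_pM2l q0) !mulrBr mulr1 [q * (p / q)]mulrC divfK ?gt_eqF//.
lra.
Qed.

Lemma entropy_ge q c : 0 <= q -> - expR (c - 1) <= q * ln q - c * q.
Proof.
move=> q0; have [->|qp] := eqVneq q (expR (c - 1)).
  by rewrite expRK; lra.
have := entropy_subgradient (expR_gt0 (c - 1)) q0 qp; rewrite expRK; lra.
Qed.

Lemma entropy_continuous : continuous (fun q : R => q * ln q).
Proof.
move=> q; have [q0|q0|q0] := ltgtP q 0; last first.
- rewrite q0 /continuous_at mul0r.
  apply: (@squeeze_cvgr _ _ _ _ (fun x => - (2 * Num.sqrt x)) (fun=> 0)).
  + near=> x; have [x0|x0] := leP x 0.
      by rewrite ln0// mulr0 lexx oppr_le0 mulr_ge0// sqrtr_ge0.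
    have x1 : x <= 1 by apply: ltW; near: x; exact: lt_nbhsl ltr01.
    rewrite pmulr_rle0// ln_le0// andbT.
    (* with s = sqrt x, ln (1 / s) < 1 / s gives - 2 s < x ln x *)
    have [s s0 ->] : exists2 s : R, 0 < s & x = s ^+ 2.
      by exists (Num.sqrt x); rewrite ?sqrtr_gt0// sqr_sqrtr// ltW.
    have /ln_sublinear : 0 < s^-1 by rewrite invr_gt0.
    rewrite sqrtr_sqr gtr0_norm// lnXn// lnV ?posrE// => /ltW/(ler_wpM2l (ltW s0)).
    rewrite divff ?gt_eqF// => /(ler_wpM2l (ltW s0)); lra.
  + have /(_ 0) : continuous (fun x : R => - (2 * Num.sqrt x)).
      move=> x; apply: cvgN; apply: cvgM; first exact: cvg_cst.
      exact: sqrt_continuous.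
    by rewrite /continuous_at sqrtr0 mulr0 oppr0.
  + exact: cvg_cst.
- by apply: cvgM => //; exact: continuous_ln.
- apply: (@near_cst_continuous _ _ 0); near=> x; rewrite ln0 ?mulr0//.
  by apply: ltW; near: x; exact: lt_nbhsl q0.
Unshelve. all: by end_near. Qed.

End Entropy.

Lemma ltr_sum_exists (R : realDomainType) (I : finType) (f g : I -> R) (i : I) :
  (forall j, f j <= g j) -> f i < g i -> \sum_j f j < \sum_j g j.
Proof.
move=> fg fgi; rewrite (bigD1 i)//= [ltRHS](bigD1 i)//=.
by rewrite ltr_leD// ler_sum.
Qed.

Section Market.
Variables (R : realType) (G : market R).
Implicit Types (x y : ll_point G) (rho : elt (riders G) -> R).

Lemma reachable_unit_flow (i j : node G) : reachable i j ->
  exists2 v : link G -> R, (forall a, 0 <= v a) & balanced_flow v 1 i j.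
Proof.
case/connectP => p; elim: p i => [|k p IH] i /= => [_ ->|/andP[]].
  exists (fun=> 0) => // n.
  by rewrite /od subrr mulr0 big1// => a _; rewrite mulr0.
move=> /existsP[a0 /andP[/eqP sa /eqP fa]] kp jE; have [v v0 vb] := IH k kp jE.
exists (fun a => v a + (a == a0)%:R) => [a|n]; first by rewrite addr_ge0// ler0n.
under eq_bigr do rewrite mulrDr.
rewrite big_split/= vb (bigD1 a0)//= eqxx mulr1 big1 => [|a /negbTE->]; last first.
  by rewrite mulr0.
by rewrite /incidence /od sa fa ![_ == n]eq_sym; ring.
Qed.

Lemma exists_feasible :
  (0 < #|riders G|)%N ->
  (forall r s : node G, r \in drivers G -> s \in riders G -> reachable r s) ->
  (forall s k : node G, s \in riders G -> k \in dests G -> reachable s k) ->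
  (forall r : elt (drivers G), 0 <= Q r) ->
  (forall s : elt (riders G), 0 <= Dbar s) ->
  (forall (s : elt (riders G)) (k : elt (dests G)), 0 <= delta s k) ->
  exists x : ll_point G, ll_feasible x.
Proof.
move=> nS rs sk Q0 D0 d0.
have hrs (p : elt (drivers G) * elt (riders G)) : exists v : link G -> R,
    (forall a, 0 <= v a) /\ balanced_flow v 1 (val p.1) (val p.2).
  by have [v ? ?] := reachable_unit_flow (rs _ _ (valP p.1) (valP p.2)); exists v.
have hsk (p : elt (riders G) * elt (dests G)) : exists v : link G -> R,
    (forall a, 0 <= v a) /\ balanced_flow v 1 (val p.1) (val p.2).
  by have [v ? ?] := reachable_unit_flow (sk _ _ (valP p.1) (valP p.2)); exists v.
have [u hu] := choice hrs; have [w hw] := choice hsk.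
pose q (r : elt (drivers G)) : R := Q r / #|riders G|%:R.
have q0 r : 0 <= q r by rewrite divr_ge0.
have scale (v : link G -> R) d i j :
    balanced_flow v 1 i j -> balanced_flow (fun a => d * v a) d i j.
  move=> vb n; under eq_bigr do rewrite mulrCA.
  by rewrite -mulr_sumr vb mul1r.
exists (LLPoint (fun r s a => q r * u (r, s) a)
  (fun s k a => demand_sk s k * w (s, k) a) (fun r _ => q r)).
split => /=.
- by move=> r s a; rewrite mulr_ge0//; exact: (hu (r, s)).1.
- by move=> s k a; rewrite !mulr_ge0//; exact: (hw (s, k)).1.
- by [].
- by move=> r s; apply: scale; exact: (hu (r, s)).2.
- by move=> s k; apply: scale; exact: (hw (s, k)).2.
- move=> r; rewrite sumr_const card_sig -mulr_natr /q.
  by rewrite divfK// pnatr_eq0 -lt0n.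
Qed.

Definition mix (l : R) x y : ll_point G := LLPoint
  (fun r s a => (1 - l) * vhat x r s a + l * vhat y r s a)
  (fun s k a => (1 - l) * vcheck x s k a + l * vcheck y s k a)
  (fun r s => (1 - l) * reloc x r s + l * reloc y r s).

Lemma sum_mix (I : finType) (f g : I -> R) (l : R) :
  \sum_i ((1 - l) * f i + l * g i) = (1 - l) * \sum_i f i + l * \sum_i g i.
Proof. by rewrite big_split/= -!mulr_sumr. Qed.

Lemma link_flow_mix l x y a :
  link_flow (mix l x y) a = (1 - l) * link_flow x a + l * link_flow y a.
Proof.
rewrite /link_flow /=; under eq_bigr do rewrite sum_mix.
by under [X in _ + X]eq_bigr do rewrite sum_mix; rewrite !sum_mix; ring.
Qed.

Lemma mix_feasible l x y : 0 <= l <= 1 ->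
  ll_feasible x -> ll_feasible y -> ll_feasible (mix l x y).
Proof.
move=> /andP[l0 l1] [x1 x2 x3 x4 x5 x6] [y1 y2 y3 y4 y5 y6].
have l'0 : 0 <= 1 - l by lra.
split => /=; try by move=> *; rewrite addr_ge0// mulr_ge0.
- move=> r s n; under eq_bigr do rewrite mulrDr ![incidence _ _ * (_ * _)]mulrCA.
  by rewrite sum_mix x4 y4; ring.
- move=> s k n; under eq_bigr do rewrite mulrDr ![incidence _ _ * (_ * _)]mulrCA.
  by rewrite sum_mix x5 y5; ring.
- by move=> r; rewrite sum_mix x6 y6; ring.
Qed.

Lemma link_flow_ge0 x a : ll_feasible x -> 0 <= link_flow x a.
Proof.
by move=> [x1 x2 _ _ _ _]; rewrite addr_ge0//; do 2 apply: sumr_ge0 => ? _.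
Qed.

Definition supply x (s : elt (riders G)) : R := \sum_r reloc x r s.

Lemma supply_mix l x y s :
  supply (mix l x y) s = (1 - l) * supply x s + l * supply y s.
Proof. exact: sum_mix. Qed.

Lemma ll_obj_price rho x : ll_obj rho x =
  ll_obj (fun=> 0) x - (beta1 G)^-1 * beta2 G * \sum_s rho s * supply x s.
Proof.
rewrite /ll_obj -addrA; congr (_ + _).
rewrite -mulrA -mulrBr; congr (_ * _).
rewrite exchange_big [X in _ = X - _]exchange_big/= mulr_sumr -sumrB.
apply: eq_bigr => s _; rewrite /supply !mulr_sumr -sumrB.
by apply: eq_bigr => r _; ring.
Qed.

Hypotheses (ttime_cont : forall a : link G,
    {within `[0, +oo[%classic, continuous (ttime a)})
  (ttime_incr : forall (a : link G) (u w : R),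
    0 <= u -> u < w -> ttime a u < ttime a w)
  (beta1_gt0 : 0 < beta1 G).

Let reloc_cost_mix (c l p q : R) : 0 < l < 1 -> 0 <= p -> 0 <= q -> p != q ->
  ((1 - l) * p + l * q) * (ln ((1 - l) * p + l * q) - c) <
  (1 - l) * (p * (ln p - c)) + l * (q * (ln q - c)).
Proof.
move=> /andP[l0 l1] p0 q0 pq; set m := (1 - l) * p + l * q.
have l1' : 0 < 1 - l by lra.
have m0 : 0 < m.
  have [pE|pn0] := eqVneq p 0; last first.
    by rewrite ltr_wpDr ?mulr_ge0 ?(ltW l0)// mulr_gt0// lt_def pn0.
  by rewrite ltr_wpDl ?mulr_ge0 ?(ltW l1')// mulr_gt0// lt_def q0 -pE eq_sym pq.
have pm : p != m.
  apply: contra pq => /eqP pE; apply/eqP/(mulfI (lt0r_neq0 l0)).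
  by move: pE; rewrite /m; lra.
have qm : q != m.
  apply: contra pq => /eqP qE; apply/eqP/(mulfI (lt0r_neq0 l1')).
  by move: qE; rewrite /m; lra.
have := entropy_subgradient m0 p0 pm; rewrite -(ltr_pM2l l1').
have := entropy_subgradient m0 q0 qm; rewrite -(ltr_pM2l l0).
set L := ln m; rewrite /m; nra.
Qed.

Lemma ll_obj_mix rho l x y : 0 < l < 1 -> ll_feasible x -> ll_feasible y ->
  ll_obj rho (mix l x y) <= (1 - l) * ll_obj rho x + l * ll_obj rho y /\
  (reloc x <> reloc y ->
   ll_obj rho (mix l x y) < (1 - l) * ll_obj rho x + l * ll_obj rho y).
Proof.
move=> l01 fx fy; have /andP[l0 l1] := l01; have l1' : 0 < 1 - l by lra.
pose q r s := reloc (mix l x y) r s * (ln (reloc (mix l x y) r s) - 1 -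
  beta2 G * rho s - beta0 s).
pose q' r s :=
  (1 - l) * (reloc x r s * (ln (reloc x r s) - 1 - beta2 G * rho s - beta0 s)) +
  l * (reloc y r s * (ln (reloc y r s) - 1 - beta2 G * rho s - beta0 s)).
have qlt r s : reloc x r s != reloc y r s -> q r s < q' r s.
  move=> xy; have := reloc_cost_mix (1 + beta2 G * rho s + beta0 s) l01
    (reloc_ge0 fx r s) (reloc_ge0 fy r s) xy.
  by rewrite /q /q' /= !opprD !addrA.
have qle r s : q r s <= q' r s.
  have [xy|/qlt/ltW//] := eqVneq (reloc x r s) (reloc y r s).
  have mixK (u : R) : (1 - l) * u + l * u = u by ring.
  by rewrite /q /q' /= xy !mixK.
pose F (a : link G) (v : R) : R := \int[lebesgue_measure]_(u in `[0, v]) (ttime a u).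
have Fle a : F a (link_flow (mix l x y) a) <=
    (1 - l) * F a (link_flow x a) + l * F a (link_flow y a).
  rewrite link_flow_mix; set m := _ + _.
  have vx := link_flow_ge0 a fx; have vy := link_flow_ge0 a fy.
  have m0 : 0 <= m by rewrite addr_ge0// mulr_ge0// ltW.
  have sub w := @travel_cost_subgradient _ _ (@ttime_cont a) (@ttime_incr a) m w m0.
  have := ler_wpM2l (ltW l1') (sub _ vx); have := ler_wpM2l (ltW l0) (sub _ vy).
  rewrite -/(F a _) -/(F a _) -/(F a _); set t := ttime a m; rewrite /m; nra.
have FleS := ler_sum (index_enum (link G)) (fun a (_ : true) => Fle a).
have rhsE : (1 - l) * ll_obj rho x + l * ll_obj rho y =
    (\sum_a ((1 - l) * F a (link_flow x a) + l * F a (link_flow y a))) +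
    (beta1 G)^-1 * \sum_r \sum_s q' r s.
  rewrite (eq_bigr _ (fun r _ => sum_mix _ _ _)) !sum_mix /ll_obj /F; ring.
rewrite rhsE /ll_obj; split.
  apply: lerD => //; rewrite ler_pM2l ?invr_gt0//.
  by apply: ler_sum => r _; apply: ler_sum => s _; exact: qle.
move=> xy; apply: ler_ltD => //; rewrite ltr_pM2l ?invr_gt0//.
have [r [s rs]] : exists r s, reloc x r s != reloc y r s.
  apply: contrapT => /forallNP h; apply: xy; apply/funext => r; apply/funext => s.
  by apply/eqP; apply: contrapT => /negP rs; apply: (h r); exists s.
apply: (ltr_sum_exists (i := r)) => [r'|].
  by apply: ler_sum => s' _; exact: qle.
by apply: (ltr_sum_exists (i := s)) => [s'|]; [exact: qle|exact: qlt].
Qed.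

Lemma ll_optimal_reloc_unique rho x y :
  ll_optimal rho x -> ll_optimal rho y -> reloc x = reloc y.
Proof.
move=> [fx ox] [fy oy]; apply: contrapT => xy.
have h2 : 0 < (2^-1 : R) < 1 by lra.
have [_ /(_ xy)] := ll_obj_mix rho h2 fx fy.
have fz : ll_feasible (mix 2^-1 x y) by apply: mix_feasible => //; lra.
have := ox _ fz; have := oy _ fz; have := ox _ fy; have := oy _ fx; lra.
Qed.

End Market.

Lemma continuous_sum (T : topologicalType) (R : realType) (I : finType)
  (f : I -> T -> R) :
  (forall i, continuous (f i)) -> continuous (fun x => \sum_i f i x).
Proof. by move=> fc; apply: continuous_big => //; exact: add_continuous. Qed.

Section Continuity.
Variables (R : realType) (G : market R) (T : topologicalType) (X : T -> ll_point G).
Hypotheses (vhat_cont : forall r s a, continuous (fun f => vhat (X f) r s a))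
  (vcheck_cont : forall s k a, continuous (fun f => vcheck (X f) s k a))
  (reloc_cont : forall r s, continuous (fun f => reloc (X f) r s)).

Lemma link_flow_continuous a : continuous (fun f => link_flow (X f) a).
Proof.
move=> f; apply: cvgD.
  by apply: continuous_sum => r; apply: continuous_sum => s; exact: vhat_cont.
by apply: continuous_sum => s; apply: continuous_sum => k; exact: vcheck_cont.
Qed.

Lemma supply_continuous s : continuous (fun f => supply (X f) s).
Proof. by apply: continuous_sum => r; exact: reloc_cont. Qed.

Lemma balanced_flow_closed (v : T -> link G -> R) (d : T -> R) i j :
  (forall a, continuous (fun f => v f a)) -> continuous d ->
  closed [set f | balanced_flow (v f) (d f) i j].
Proof.
move=> vc dc.
pose h n f := \sum_a incidence n a * v f a - d f * od i j n.
rewrite (_ : [set _ | _] = \bigcap_n [set f | h n f = 0]); last first.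
  apply/seteqP; split=> f /= vb n => [_|]; first by rewrite /= /h vb subrr.
  by apply/eqP; rewrite -subr_eq0; apply/eqP; exact: vb.
apply: closed_bigI => n _; apply: (@preimage_closed _ _ (h n) [set 0]).
  move=> f _; apply: cvgB.
    apply: continuous_sum => a {}f; apply: cvgM; first exact: cvg_cst.
    exact: vc.
  by apply: cvgM; [exact: dc|exact: cvg_cst].
exact: closed_eq.
Qed.

Lemma continuous_ge0_closed (h : T -> R) :
  continuous h -> closed [set f | 0 <= h f].
Proof.
by move=> hc; apply: (@preimage_closed _ _ h [set x | 0 <= x]) => //; exact: closed_ge.
Qed.

Lemma ll_feasible_closed : closed [set f | ll_feasible (X f)].
Proof.
have cst0 (c : R) : continuous (fun _ : T => c) by move=> f; exact: cvg_cst.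
rewrite (_ : [set _ | _] =
  \bigcap_r \bigcap_s \bigcap_a [set f | 0 <= vhat (X f) r s a] `&`
  \bigcap_s \bigcap_k \bigcap_a [set f | 0 <= vcheck (X f) s k a] `&`
  \bigcap_r \bigcap_s [set f | 0 <= reloc (X f) r s] `&`
  \bigcap_r \bigcap_s [set f |
    balanced_flow (vhat (X f) r s) (reloc (X f) r s) (val r) (val s)] `&`
  \bigcap_s \bigcap_k [set f |
    balanced_flow (vcheck (X f) s k) (demand_sk s k) (val s) (val k)] `&`
  \bigcap_r [set f | \sum_s reloc (X f) r s = Q r]).
  repeat apply: closedI; repeat (apply: closed_bigI => ? _).
  - exact: continuous_ge0_closed.
  - exact: continuous_ge0_closed.
  - exact: continuous_ge0_closed.
  - exact: balanced_flow_closed.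
  - exact: balanced_flow_closed.
  - apply: (@preimage_closed _ _ _ [set x | x = Q _]); last exact: closed_eq.
    by move=> f _; apply: continuous_sum => s; exact: reloc_cont.
apply/seteqP; split=> f /=.
  move=> [h1 h2 h3 h4 h5 h6].
  by split; first (split; first (split; first (split; first split)));
    repeat (move=> ? _) => /=.
move=> [[[[[h1 h2] h3] h4] h5] h6]; split.
- by move=> r s a; exact: (h1 r I s I a I).
- by move=> s k a; exact: (h2 s I k I a I).
- by move=> r s; exact: (h3 r I s I).
- by move=> r s; exact: (h4 r I s I).
- by move=> s k; exact: (h5 s I k I).
- by move=> r; exact: (h6 r I).
Qed.

End Continuity.

Section Equilibrium.
Variables (R : realType) (G : market R).
Hypotheses (ttime_ge0 : forall (a : link G) (u : R), 0 <= u -> 0 <= ttime a u)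
  (ttime_cont : forall a : link G,
    {within `[0, +oo[%classic, continuous (ttime a)})
  (ttime_incr : forall (a : link G) (u w : R),
    0 <= u -> u < w -> ttime a u < ttime a w)
  (beta1_gt0 : 0 < beta1 G) (beta2_gt0 : 0 < beta2 G)
  (b_gt0 : forall s : elt (riders G), 0 < b s).
Implicit Types (x y : ll_point G) (rho : elt (riders G) -> R).

Let kappa : R := (beta1 G)^-1 * beta2 G.

Let kappa_gt0 : 0 < kappa.
Proof. by rewrite mulr_gt0// invr_gt0. Qed.

(* The last sum is minus the integral over [0, supply x s] of the inverse demand
   (D s - u) / b s, up to the factor kappa. *)
Definition market_obj x : R := ll_obj (fun=> 0) x +
  kappa * \sum_s supply x s * (supply x s / 2 - D s) / b s.

Lemma market_obj_continuous (T : topologicalType) (X : T -> ll_point G) :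
  (forall r s a, continuous (fun f => vhat (X f) r s a)) ->
  (forall s k a, continuous (fun f => vcheck (X f) s k a)) ->
  (forall r s, continuous (fun f => reloc (X f) r s)) ->
  continuous (fun f => market_obj (X f)).
Proof.
move=> hc cc rc f; apply: cvgD; first apply: cvgD.
- apply: continuous_sum => a {}f.
  apply: (@continuous_comp _ _ _ (fun f => link_flow (X f) a)
    (fun v => \int[lebesgue_measure]_(u in `[0, v]) (ttime a u))).
    exact: link_flow_continuous.
  exact: (travel_cost_continuous (@ttime_ge0 a) (@ttime_cont a) (@ttime_incr a)).
- apply: cvgM; first exact: cvg_cst.
  apply: continuous_sum => r; apply: continuous_sum => s {}f.
  rewrite /continuous_at.
  under eq_fun do rewrite -!addrA mulrDr; rewrite -!addrA mulrDr.
  apply: cvgD; last by apply: cvgM; [exact: rc|exact: cvg_cst].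
  apply: (@continuous_comp _ _ _ (fun f => reloc (X f) r s) (fun q => q * ln q)).
    exact: rc.
  exact: entropy_continuous.
- apply: cvgM; first exact: cvg_cst.
  apply: continuous_sum => s {}f.
  have sc : continuous (fun f => supply (X f) s) by exact: supply_continuous.
  apply: cvgM; last exact: cvg_cst.
  apply: cvgM; first exact: sc.
  apply: cvgB; last exact: cvg_cst.
  by apply: cvgM; [exact: sc|exact: cvg_cst].
Qed.

Lemma market_obj_coercive (C : R) : exists M : link G -> R,
  forall x, ll_feasible x -> market_obj x <= C -> forall a, link_flow x a <= M a.
Proof.
pose B : R := (beta1 G)^-1 *
    (\sum_(r : elt (drivers G)) \sum_(s : elt (riders G)) expR (beta0 s)) +
  kappa * \sum_(s : elt (riders G)) (D s ^+ 2 / 2) / b s.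
exists (fun a => 1 + (C + B) / ttime a 1) => x fx xC a.
pose F (a : link G) (v : R) : R := \int[lebesgue_measure]_(u in `[0, v]) (ttime a u).
have F0 a' v : 0 <= F a' v by exact: (travel_cost_ge0 (@ttime_ge0 a')).
have FCB : F a (link_flow x a) <= C + B.
  have S0 : 0 <= \sum_(a' | a' != a) F a' (link_flow x a') by exact: sumr_ge0.
  have : market_obj x = F a (link_flow x a) +
      \sum_(a' | a' != a) F a' (link_flow x a') +
      (beta1 G)^-1 * (\sum_r \sum_s reloc x r s *
         (ln (reloc x r s) - 1 - beta2 G * 0 - beta0 s)) +
      kappa * \sum_s supply x s * (supply x s / 2 - D s) / b s.
    by rewrite /market_obj /ll_obj (bigD1 a).
  have : - \sum_(r : elt (drivers G)) \sum_(s : elt (riders G)) expR (beta0 s) <=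
      \sum_r \sum_s reloc x r s *
         (ln (reloc x r s) - 1 - beta2 G * 0 - beta0 s).
    rewrite -sumrN; apply: ler_sum => r _; rewrite -sumrN; apply: ler_sum => s _.
    have := entropy_ge (1 + beta0 s) (reloc_ge0 fx r s).
    by rewrite [1 + _ - 1]addrC addKr => h; lra.
  have : - \sum_(s : elt (riders G)) (D s ^+ 2 / 2) / b s <=
      \sum_s supply x s * (supply x s / 2 - D s) / b s.
    rewrite -sumrN; apply: ler_sum => s _; rewrite -mulNr ler_pM2r ?invr_gt0//.
    by have := sqr_ge0 (supply x s - D s); lra.
  rewrite -(ler_pM2l kappa_gt0) => h1.
  have bi : 0 < (beta1 G)^-1 by rewrite invr_gt0.
  rewrite -(ler_pM2l bi) => h2 obj; rewrite /B; lra.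
have t1 : 0 < ttime a 1 by exact: le_lt_trans (ttime_ge0 a (lexx 0)) (ttime_incr a (lexx 0) ltr01).
have := travel_cost_subgradient (@ttime_cont a) (@ttime_incr a) ler01 (link_flow_ge0 a fx).
rewrite -/(F a 1) -/(F a _) -lerBlDl ler_pdivlMr// mulrC.
by have := F0 a 1; lra.
Qed.

Let coord : finType := (elt (drivers G) * elt (riders G) * link G +
  elt (riders G) * elt (dests G) * link G + elt (drivers G) * elt (riders G))%type.

Let point (f : coord -> R) : ll_point G := LLPoint
  (fun r s a => f (inl (inl (r, s, a)))) (fun s k a => f (inl (inr (s, k, a))))
  (fun r s => f (inr (r, s))).

Let coords x (i : coord) : R := match i with
  | inl (inl (r, s, a)) => vhat x r s a
  | inl (inr (s, k, a)) => vcheck x s k a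
  | inr (r, s) => reloc x r s
  end.

Let coordsK x : point (coords x) = x.
Proof. by case: x. Qed.

Lemma exists_market_min : (exists x, ll_feasible x) ->
  exists2 x, ll_feasible x &
    forall y, ll_feasible y -> market_obj x <= market_obj y.
Proof.
move=> [x0 f0]; have [M HM] := market_obj_coercive (market_obj x0).
pose T : topologicalType := prod_topology (fun _ : coord => R).
have cc (i : coord) : continuous (fun f : T => f i).
  exact: (@proj_continuous coord (fun=> R)).
pose A : set T := [set f | ll_feasible (point f)] `&`
  \bigcap_a [set f | link_flow (point f) a <= M a].
have Acl : closed A.
  apply: closedI; first by apply: ll_feasible_closed => *; exact: cc.
  apply: closed_bigI => a _.
  apply: (@preimage_closed _ _ (fun f : T => link_flow (point f) a) [set v | v <= M a]).
    by move=> f _; apply: link_flow_continuous => *; exact: cc.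
  exact: closed_le.
pose bound (i : coord) : R := match i with
  | inl (inl (_, a)) => M a | inl (inr (_, a)) => M a | inr (r, _) => Q r end.
have Ac : compact A.
  apply: (subclosed_compact Acl (tychonoff (fun i => @segment_compact R 0 (bound i)))).
  move=> f [ff fM]; have [h1 h2 h3 _ _ h6] := ff.
  have le_sum (I : finType) (g : I -> R) i : (forall j, 0 <= g j) -> g i <= \sum_j g j.
    by move=> g0; rewrite (bigD1 i)//= lerDl sumr_ge0.
  case=> [[[[r s] a]|[[s k] a]]|[r s]]; rewrite /= in_itv/=.
  - rewrite h1/=; apply: le_trans (fM a I); rewrite /link_flow/=.
    apply: ler_wpDr; first by do 2 apply: sumr_ge0 => ? _; exact: h2.
    apply: le_trans (le_sum _ (fun r => \sum_s _) r _); last first.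
      by move=> ?; apply: sumr_ge0 => ? _; exact: h1.
    by apply: (le_sum _ (fun s => vhat (point f) r s a)) => ?; exact: h1.
  - rewrite h2/=; apply: le_trans (fM a I); rewrite /link_flow/=.
    apply: ler_wpDl; first by do 2 apply: sumr_ge0 => ? _; exact: h1.
    apply: le_trans (le_sum _ (fun s => \sum_k _) s _); last first.
      by move=> ?; apply: sumr_ge0 => ? _; exact: h2.
    by apply: (le_sum _ (fun k => vcheck (point f) s k a)) => ?; exact: h2.
  - by rewrite h3/= -h6; apply: (le_sum _ (reloc (point f) r)); exact: h3.
have Ain x : ll_feasible x -> market_obj x <= market_obj x0 -> A (coords x).
  by move=> fx xx0; split=> [|a _]; rewrite /= coordsK//; exact: HM.
have A0 : A !=set0 by exists (coords x0); exact: Ain.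
have [|f fA fmin] := @compact_EVT_min T R (fun f => market_obj (point f)) A A0 Ac.
  by apply: continuous_subspaceT; apply: market_obj_continuous => *; exact: cc.
move: fA; rewrite inE => -[ff _]; exists (point f) => // y fy.
have [yx0|/ltW x0y] := leP (market_obj y) (market_obj x0).
  by have := fmin (coords y); rewrite coordsK; apply; rewrite inE; exact: Ain.
apply: le_trans x0y; have := fmin (coords x0); rewrite coordsK; apply.
by rewrite inE; exact: Ain.
Qed.

(* Comparing x with (1 - l) x + l y and letting l tend to 0 replaces the
   quadratic part of [market_obj] by its gradient at x. *)
Lemma market_min_ll_optimal x : ll_feasible x ->
  (forall y, ll_feasible y -> market_obj x <= market_obj y) ->
  ll_optimal (fun s => (D s - supply x s) / b s) x.
Proof.
move=> fx xmin; split => // y fy; set rho := fun s => _.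
rewrite -subr_ge0; set gap := _ - _.
pose K := kappa * \sum_s (supply y s - supply x s) ^+ 2 / 2 / b s.
have K0 : 0 <= K.
  by rewrite mulr_ge0 ?(ltW kappa_gt0)// sumr_ge0// => s _; rewrite !divr_ge0 ?sqr_ge0 ?ltW.
have step l : 0 < l < 1 -> 0 <= gap + l * K.
  move=> l01; have /andP[l0 l1] := l01.
  have fz : ll_feasible (mix l x y) by apply: mix_feasible => //; lra.
  have [cvx _] := ll_obj_mix ttime_cont ttime_incr beta1_gt0 (fun=> 0) l01 fx fy.
  have := xmin _ fz; rewrite /market_obj.
  have -> : \sum_s supply (mix l x y) s * (supply (mix l x y) s / 2 - D s) / b s =
      \sum_s supply x s * (supply x s / 2 - D s) / b s -
      l * (\sum_s rho s * supply y s - \sum_s rho s * supply x s) +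
      l * l * \sum_s (supply y s - supply x s) ^+ 2 / 2 / b s.
    rewrite -[X in l * X]sumrB !mulr_sumr -sumrB -big_split/=.
    by apply: eq_bigr => s _; rewrite supply_mix /rho; field; rewrite gt_eqF.
  move=> h; rewrite -(pmulr_rge0 _ l0).
  have -> : gap = ll_obj (fun=> 0) y - ll_obj (fun=> 0) x -
      (kappa * (\sum_s rho s * supply y s) - kappa * (\sum_s rho s * supply x s)).
    by rewrite /gap /kappa (ll_obj_price rho y) (ll_obj_price rho x); ring.
  by move: h cvx; rewrite /K; lra.
rewrite leNgt; apply/negP => gap0.
have den : 0 < 1 - gap + K by lra.
have lden : - gap / (1 - gap + K) * (1 - gap + K) = - gap by rewrite divfK ?gt_eqF.
have /step : 0 < - gap / (1 - gap + K) < 1.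
  by rewrite divr_gt0 ?ltr_pdivrMr ?mul1r//=; lra.
set l := - gap / _ in lden *; rewrite -(pmulr_rge0 _ den) mulrDr.
have -> : (1 - gap + K) * (l * K) = - gap * K by rewrite mulrA [_ * l]mulrC lden.
by nra.
Qed.

(* Supply is monotone in the price: this follows by adding the two lower-level
   optimality inequalities. Demand is strictly decreasing. *)
Lemma balanced_price_unique rho rho' x x' :
  ll_optimal rho x -> ll_optimal rho' x' ->
  (forall s, supply x s = D s - b s * rho s) ->
  (forall s, supply x' s = D s - b s * rho' s) -> rho = rho'.
Proof.
move=> [fx ox] [fx' ox'] bx bx'.
have := ox _ fx'; have := ox' _ fx; rewrite ![ll_obj rho _]ll_obj_price ![ll_obj rho' _]ll_obj_price.
rewrite -/kappa => h1 h2.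
have : kappa * \sum_s b s * (rho s - rho' s) ^+ 2 <= 0.
  have -> : \sum_s b s * (rho s - rho' s) ^+ 2 =
     (\sum_s rho s * supply x' s - \sum_s rho s * supply x s) +
     (\sum_s rho' s * supply x s - \sum_s rho' s * supply x' s).
    rewrite -!sumrB -big_split/=; apply: eq_bigr => s _; rewrite bx bx'; ring.
  by lra.
rewrite pmulr_rle0// => sum_le0; apply/funext => s.
have t0 s' : true -> 0 <= b s' * (rho s' - rho' s') ^+ 2.
  by rewrite mulr_ge0 ?sqr_ge0 ?ltW.
have /(psumr_eq0P t0)/(_ s isT)/eqP : \sum_s b s * (rho s - rho' s) ^+ 2 = 0.
  by apply/le_anti; rewrite sum_le0 sumr_ge0.
by rewrite mulf_eq0 gt_eqF//= sqrf_eq0 subr_eq0 => /eqP.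
Qed.

End Equilibrium.

Theorem lemma2 (R : realType) (G : market R)
  (riders_neq0 : (0 < #|riders G|)%N)
  (reach_rs : forall r s : node G,
     r \in drivers G -> s \in riders G -> reachable r s)
  (reach_sk : forall s k : node G,
     s \in riders G -> k \in dests G -> reachable s k)
  (ttime_ge0 : forall (a : link G) (u : R), 0 <= u -> 0 <= ttime a u)
  (ttime_cont : forall a : link G,
     {within `[0, +oo[%classic, continuous (ttime a)})
  (ttime_incr : forall (a : link G) (u w : R),
     0 <= u -> u < w -> ttime a u < ttime a w)
  (Q_gt0 : forall r : elt (drivers G), 0 < Q r)
  (Dbar_ge0 : forall s : elt (riders G), 0 <= Dbar s)
  (delta_ge0 : forall (s : elt (riders G)) (k : elt (dests G)), 0 <= delta s k)
  (beta1_gt0 : 0 < beta1 G)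
  (beta2_gt0 : 0 < beta2 G)
  (b_gt0 : forall s : elt (riders G), 0 < b s) :
  (forall rho : elt (riders G) -> R, bilevel_optimal rho <-> market_balanced rho)
  /\ exists! rho : elt (riders G) -> R, bilevel_optimal rho.
Proof.
have [x fx xmin] := exists_market_min ttime_ge0 ttime_cont ttime_incr beta1_gt0
  beta2_gt0 b_gt0 (exists_feasible riders_neq0 reach_rs reach_sk
    (fun r => ltW (Q_gt0 r)) Dbar_ge0 delta_ge0).
pose rho0 s := (D s - supply x s) / b s.
have opt0 : ll_optimal rho0 x by exact: market_min_ll_optimal.
have bal0 s : supply x s = D s - b s * rho0 s.
  by rewrite /rho0 mulrC divfK ?gt_eqF// opprB addrC subrK.
have uniq_reloc := ll_optimal_reloc_unique ttime_cont ttime_incr beta1_gt0.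
have optP (rho : elt (riders G) -> R) : bilevel_optimal rho <-> market_balanced rho.
  split=> [[m [q [[[y oy <-] mE] mmin]]]|[q [[oq _] bq]]].
  - have m_ge0 s : true -> 0 <= m s by rewrite mE.
    have sum0 : \sum_s m s = 0.
      apply/le_anti; rewrite sumr_ge0// andbT.
      rewrite (le_trans (mmin rho0 (fun=> 0) (reloc x) _))// ?big1//.
      split=> [|s]; first by exists x.
      by rewrite [\sum_r _]bal0 subrr normr0.
    exists (reloc y); split; last first.
      move=> s; apply/eqP; rewrite -subr_eq0 -normr_eq0 -mE.
      exact/eqP/(psumr_eq0P m_ge0 sum0).
    by split=> [|_ [z oz <-]]; [exists y|exact: uniq_reloc oy oz].
  - exists (fun=> 0), q; split.
      by split=> // s; rewrite bq subrr normr0.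
    move=> rho' m' q' [_ m'E]; rewrite big1//; apply: sumr_ge0 => s _.
    by rewrite m'E.
split=> //; exists rho0; split=> [|rho].
  apply/optP; exists (reloc x); split=> //.
  by split=> [|_ [z oz <-]]; [exists x|exact: uniq_reloc opt0 oz].
move=> /optP[_ [[[y oy <-] _] bal]].
exact: (balanced_price_unique beta1_gt0 beta2_gt0 b_gt0 opt0 oy bal0 bal).
Qed.
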